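(* Let $\mathcal{C}=(C,Q,\mathcal{T})$ be a counter system (with initial states $c_0\in C$, $Q_0\subseteq Q$) that is fully $\preceq_0$-compatible, and let $\mathcal{C}_\alpha$ be its $01$-counter system. Then $\mathsf{Traces}(\mathcal{C})=\mathsf{Traces}(\mathcal{C}_\alpha)$.
   Context: For $\mathbf{v}\in\mathbb{N}^Q$ let $|\mathbf{v}|=\sum_{q\in Q}\mathbf{v}(q)$. A counter system (CS) is a triple $\mathcal{C}=(C,Q,\mathcal{T})$ with $C$ a finite set (controller states), $Q$ a finite set (user states), and a size-preserving step relation $\mathcal{T}\subseteq(C\times\mathbb{N}^Q)\times(C\times\mathbb{N}^Q)$ ($|\mathbf{v}|=|\mathbf{v}'|$ whenever $((c,\mathbf{v}),(c',\mathbf{v}'))\in\mathcal{T}$). Write $(c,\mathbf{v})\to(c',\mathbf{v}')$ for $((c,\mathbf{v}),(c',\mathbf{v}'))\in\mathcal{T}$. Initial configurations are the $(c_0,\mathbf{v}_0)$ with $\mathbf{v}_0(q)=0$ for all $q\notin Q_0$. A run is a sequence of steps starting in an initial configuration. Order: $(c,\mathbf{v})\preceq_0(d,\mathbf{w})$ iff $c=d$ and, for all $q\in Q$, $\mathbf{v}(q)\le\mathbf{w}(q)$ and $(\mathbf{v}(q)=0\Leftrightarrow\mathbf{w}(q)=0)$. $\mathcal{C}$ is forward $\preceq_0$-compatible if whenever $(c,\mathbf{v})\to(c',\mathbf{v}')$ and $(c,\mathbf{v})\preceq_0(d,\mathbf{w})$, there is a step $(d,\mathbf{w})\to(d',\mathbf{w}')$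 with $(c',\mathbf{v}')\preceq_0(d',\mathbf{w}')$; backward $\preceq_0$-compatible if whenever $(c,\mathbf{v})\to(c',\mathbf{v}')$ and $(c',\mathbf{v}')\preceq_0(d',\mathbf{w}')$, there is a step $(d,\mathbf{w})\to(d',\mathbf{w}')$ with $(c,\mathbf{v})\preceq_0(d,\mathbf{w})$; fully $\preceq_0$-compatible if both. Abstraction: $\alpha(c,\mathbf{v})=(c,\mathbf{v}^\alpha)$ with $\mathbf{v}^\alpha(q)=1$ if $\mathbf{v}(q)\ge1$ and $0$ otherwise. The $01$-counter system $\mathcal{C}_\alpha$ has configurations $C\times\{0,1\}^Q$ and a step $(c,\mathbf{x})\to(c',\mathbf{x}')$ iff there is a step $(c,\mathbf{v})\to(c',\mathbf{v}')$ in $\mathcal{T}$ with $\alpha(c,\mathbf{v})=(c,\mathbf{x})$ and $\alpha(c',\mathbf{v}')=(c',\mathbf{x}')$. Its initial configurations are the $(c_0,\mathbf{x})$ with $\mathbf{x}(q)=0$ for all $q\notin Q_0$. A (finite) trace of $\mathcal{C}$ is a finite word in $C^*$ obtained from a finite run of $\mathcal{C}$ by projecting each configuration to its first component (controller state) and removing duplicate adjacent letters. $\mathsf{Traces}(\mathcal{C})$ is the set of all finite traces of $\mathcal{C}$; $\mathsf{Traces}(\mathcal{C}_\alpha)$ is defined in the same way from the runs of $\mathcal{C}_\alpha$. *)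

(* Defs.v *)
From HB Require Import structures.
From mathcomp Require Import all_boot boolp classical_sets.

Set Implicit Arguments.
Unset Strict Implicit.
Unset Printing Implicit Defensive.

Local Open Scope classical_set_scope.

Definition vsize (Q : finType) (v : {ffun Q -> nat}) : nat := \sum_(q : Q) v q.

Definition config (C Q : finType) : Type := (C * {ffun Q -> nat})%type.

(* The components C and Q of the triple (C, Q, T) are type parameters, and T is
   the field [cs_step]. *)
Record counter_system (C Q : finType) := CounterSystem {
  cs_step : set (config C Q * config C Q);
  cs_step_size : forall (c c' : C) (v v' : {ffun Q -> nat}),
    cs_step ((c, v), (c', v')) -> vsize v = vsize v'
}.

Definition cs_init (C Q : finType) (c0 : C) (Q0 : {set Q}) : set (config C Q) :=
  [set x : config C Q | x.1 = c0 /\ forall q : Q, q \notin Q0 -> x.2 q = 0].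

Definition preceq0 (C Q : finType) (x y : config C Q) : Prop :=
  x.1 = y.1 /\
  forall q : Q, x.2 q <= y.2 q /\ (x.2 q = 0 <-> y.2 q = 0).

Definition forward_compatible (C Q : finType) (S : counter_system C Q) : Prop :=
  forall x x' y : config C Q,
    cs_step S (x, x') -> preceq0 x y ->
    exists y' : config C Q, cs_step S (y, y') /\ preceq0 x' y'.

Definition backward_compatible (C Q : finType) (S : counter_system C Q) : Prop :=
  forall x x' y' : config C Q,
    cs_step S (x, x') -> preceq0 x' y' ->
    exists y : config C Q, cs_step S (y, y') /\ preceq0 x y.

Definition fully_compatible (C Q : finType) (S : counter_system C Q) : Prop :=
  forward_compatible S /\ backward_compatible S.

(* Vectors in {0,1}^Q are boolean-valued: [true] is 1 and [false] is 0. *)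
Definition config01 (C Q : finType) : Type := (C * {ffun Q -> bool})%type.

Definition alpha (C Q : finType) (x : config C Q) : config01 C Q :=
  (x.1, [ffun q : Q => 1 <= x.2 q]).

Definition step01 (C Q : finType) (S : counter_system C Q) :
    set (config01 C Q * config01 C Q) :=
  [set p : config01 C Q * config01 C Q | exists x x' : config C Q,
     [/\ cs_step S (x, x'), alpha x = p.1 & alpha x' = p.2]].

Definition init01 (C Q : finType) (c0 : C) (Q0 : {set Q}) :
    set (config01 C Q) :=
  [set x : config01 C Q | x.1 = c0 /\ forall q : Q, q \notin Q0 -> x.2 q = false].

Fixpoint destutter (C : eqType) (s : seq C) : seq C :=
  match s with
  | x :: ((y :: _) as s') => if x == y then destutter s' else x :: destutter s'
  | _ => s
  end.

(* A finite run is a nonempty sequence of configurations [x :: s]; a run with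
   no step ([s] empty) is allowed. [V] is the type of the vectors, so that the
   same definition serves a counter system and its 01-counter system. *)
Definition finite_run (C : finType) (V : Type)
    (init : set (C * V)) (step : set ((C * V) * (C * V)))
    (x : C * V) (s : seq (C * V)) : Prop :=
  init x /\ path (fun y z => (y, z) \in step) x s.

Definition traces_of (C : finType) (V : Type)
    (init : set (C * V)) (step : set ((C * V) * (C * V))) : set (seq C) :=
  [set w : seq C | exists (x : C * V) (s : seq (C * V)),
     finite_run init step x s /\ w = destutter (map fst (x :: s))].

Definition Traces (C Q : finType) (S : counter_system C Q)
    (c0 : C) (Q0 : {set Q}) : set (seq C) :=
  traces_of (cs_init c0 Q0) (cs_step S).

Definition Traces01 (C Q : finType) (S : counter_system C Q)
    (c0 : C) (Q0 : {set Q}) : set (seq C) :=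
  traces_of (init01 c0 Q0) (step01 S).

(* Main.v *)
Require Import Defs.
From mathcomp Require Import all_boot boolp classical_sets.

Set Implicit Arguments.
Unset Strict Implicit.
Unset Printing Implicit Defensive.

(** An abstract run is lifted to a concrete one starting from its last step.
    The step to be prepended has a concrete witness [z -> z'], where [z'] and
    the start of the lifted run have the same abstraction, hence a common upper
    bound [w] for [preceq0]. Forward compatibility moves the lifted run up to
    [w], and backward compatibility provides a step into [w]; neither changes
    any abstraction, because configurations related by [preceq0] have equal
    abstractions. *)

Lemma alpha_preceq0 (C Q : finType) (x y : config C Q) :
  preceq0 x y -> alpha x = alpha y.
Proof.
case=> eq1 le_xy; congr pair => //; apply/ffunP => q; rewrite !ffunE.
by have [_ [xy0 yx0]] := le_xy q; case: (x.2 q) (y.2 q) xy0 yx0 => [|m] [|n];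
  intuition discriminate.
Qed.

(** The pointwise maximum works: equal abstractions give equal controller states and the same zero
    counters, so the maximum vanishes exactly where each vector does. *)
Lemma preceq0_common_ub (C Q : finType) (x y : config C Q) :
  alpha x = alpha y -> exists z, preceq0 x z /\ preceq0 y z.
Proof.
case=> eq1 /ffunP eq2; exists (x.1, [ffun q => maxn (x.2 q) (y.2 q)]).
by split; split=> //= q; have:= eq2 q; rewrite !ffunE ?leq_maxl ?leq_maxr;
  case: (x.2 q) (y.2 q) => [|m] [|n] //; rewrite maxnSS.
Qed.

Lemma alpha_surj (C Q : finType) (a : config01 C Q) :
  exists x : config C Q, alpha x = a.
Proof.
case: a => c v; exists (c, [ffun q => v q : nat]); congr pair.
by apply/ffunP => q; rewrite !ffunE /=; case: (v q).
Qed.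

Lemma map_fst_alpha (C Q : finType) (s : seq (config C Q)) :
  map fst (map (@alpha C Q) s) = map fst s.
Proof. by rewrite -map_comp; apply: eq_map. Qed.

(** Being initial depends only on the controller state and on which counters vanish, and [alpha]
    keeps both. Hence every lift of an initial abstract configuration is initial. *)
Lemma init01_alpha (C Q : finType) (c0 : C) (Q0 : {set Q}) (x : config C Q) :
  init01 c0 Q0 (alpha x) <-> cs_init c0 Q0 x.
Proof.
split=> -[/= x1 x2]; split=> // q /x2; rewrite /= ffunE; last by move->.
by case: (x.2 q).
Qed.

Lemma path_alpha (C Q : finType) (S : counter_system C Q) x s :
  path (fun y z => (y, z) \in cs_step S) x s ->
  path (fun y z => (y, z) \in step01 S) (alpha x) (map (@alpha C Q) s).
Proof.
elim: s x => //= y s IHs x /andP[/set_mem xy /IHs ->]; rewrite andbT.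
by apply/mem_set; exists x, y.
Qed.

(** Each larger target serves as the larger source for the next step. Only abstractions are
    recorded, as they fix the controller states. *)
Lemma forward_path (C Q : finType) (S : counter_system C Q) x s y :
  forward_compatible S ->
  path (fun y z => (y, z) \in cs_step S) x s -> preceq0 x y ->
  exists2 t, path (fun y z => (y, z) \in cs_step S) y t
    & map (@alpha C Q) t = map (@alpha C Q) s.
Proof.
move=> fwd; elim: s x y => [|x' s IHs] x y /=; first by exists [::].
move=> /andP[/set_mem xx' path_s] /(fwd _ _ _ xx')[y' [yy' le_xy']].
have [t path_t eq_ts] := IHs _ _ path_s le_xy'.
exists (y' :: t); first by rewrite /= path_t andbT; apply/mem_set.
by rewrite /= eq_ts (alpha_preceq0 le_xy').
Qed.

(** The start [x] is existential because each prepended step changes the run already built and gives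
    it a new start. *)
Lemma lift_path (C Q : finType) (S : counter_system C Q) a r :
  fully_compatible S -> path (fun y z => (y, z) \in step01 S) a r ->
  exists x s, [/\ path (fun y z => (y, z) \in cs_step S) x s,
    alpha x = a & map (@alpha C Q) s = r].
Proof.
case=> fwd bwd; elim: r a => [|b r IHr] a /=.
  by have [x ax] := alpha_surj a; exists x, [::].
move=> /andP[/set_mem[z [z' [/= zz' az az']]] /IHr[x [s [path_s ax map_s]]]].
have [w [le_xw le_zw]] : exists w, preceq0 x w /\ preceq0 z' w.
  by apply: preceq0_common_ub; rewrite ax az'.
have [t path_t map_t] := forward_path fwd path_s le_xw.
have [u [uw le_zu]] := bwd _ _ _ zz' le_zw.
exists u, (w :: t); split.
- by rewrite /= path_t andbT; apply/mem_set.
- by rewrite -(alpha_preceq0 le_zu).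
- by rewrite /= map_t map_s -(alpha_preceq0 le_xw) ax.
Qed.

Theorem lemma6 (C Q : finType) (S : counter_system C Q) (c0 : C) (Q0 : {set Q})
  (hS : fully_compatible S) :
  Traces S c0 Q0 = Traces01 S c0 Q0.
Proof.
apply/seteqP; split=> w.
- move=> [x [s [[init_x path_s] ->]]].
  exists (alpha x), (map (@alpha C Q) s).
  split; last by rewrite -(map_fst_alpha (x :: s)).
  by split; [apply/init01_alpha | apply: path_alpha].
- move=> [a [r [[init_a path_r] ->]]].
  have [x [s [path_s ax map_s]]] := lift_path hS path_r.
  exists x, s; split; last by rewrite -ax -map_s -(map_fst_alpha (x :: s)).
  by split=> //; apply/init01_alpha; rewrite ax.
Qed.
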